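(* Let $\Delta$ be a non-empty connected finite flag complex. Consider the presentation of $H_\Delta$ whose generators are the directed edges of $\Delta$ and whose relators are the words $c^{[n]}=e_1^n\cdots e_l^n$ for all directed cycles $c=(e_1,\ldots,e_l)$ in $\Delta$ of length $l\ge 2$ and all non-zero integers $n$. This presentation may be simplified as follows. (a) For each directed cycle $c$ of length $l=2$, the relators $c^{[n]}$ are consequences of $c^{[1]}$. (b) For each directed cycle $c$ of length $l=3$, the relators $c^{[n]}$ are consequences of the relators $c^{[1]}$ and $c^{[-1]}$. (c) Let $c_1,\ldots,c_m$ be directed cycles in $\Delta$ such that the normal subgroup of $\pi_1(\Delta)$ generated by the conjugacy classes of $c_1,\ldots,c_m$ is the whole of $\pi_1(\Delta)$. Then each relator $c^{[n]}$ ($c$ any directed cycle of length at least 2, $n\neq 0$) is a consequence of the following relators: the finitely many relators given in (a) and (b), namely $d^{[1]}$ for all directed cycles $d$ of length 2, and $d^{[1]}$ and $d^{[-1]}$ for all directed cycles $d$ of length 3; together with the relators $c_i^{[n]}$ for all $n$ and $1\leq i\leq m$.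
   Context: A finite flag complex $\Delta$ is a finite simplicial complex that contains a simplex bounding (spanning) every complete subgraph of its 1-skeleton. The associated right-angled Artin group $G_\Delta$ is the group presented with generators the vertex set of $\Delta$ and relators the commutators $[v,w]$ for each pair of adjacent vertices. For $\Delta$ non-empty, $H_\Delta$ is the kernel of the homomorphism $G_\Delta\to\mathbf{Z}$ sending every generator to $1$. When $\Delta$ is connected, $H_\Delta$ has the presentation described in the claim, the generator $e$ corresponding to the element $\iota e\,(\tau e)^{-1}$ of $G_\Delta$. A directed edge is a 1-simplex of $\Delta$ with a choice of orientation (each 1-simplex gives two directed edges); $\iota e$ and $\tau e$ denote the initial and terminal vertices of a directed edge $e$. A directed cycle $c=(e_1,\ldots,e_l)$ of length $l$ is a closed directed edge path: $\tau e_i=\iota e_{i+1}$ for $1\le i<l$ and $\tau e_l=\iota e_1$. It determines a free homotopy class of loops in $\Delta$, i.e. a conjugacy class in $\pi_1(\Delta)$. A relator is a consequence of a set of relators if, in the free group on the set of directed edges of $\Delta$, it lies in the normal closure of that set. *)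

(* Defs.v *)
From HB Require Import structures.
From mathcomp Require Import all_boot all_order all_algebra.
From mathcomp Require Import generic_quotient.
From mathcomp Require Import all_classical all_reals all_analysis.
From mathcomp Require Import lra.

Set Implicit Arguments.
Unset Strict Implicit.
Unset Printing Implicit Defensive.

Import Order.TTheory GRing.Theory Num.Theory.
Import numFieldNormedType.Exports.

Local Open Scope ring_scope.

(* A letter (x, false) stands for x and (x, true) for its inverse; the elements
   of the free group are the reduced words. *)
Section FreeGroup.
Variable T : choiceType.
Implicit Types (a b : T * bool) (w : seq (T * bool)).

Definition linv a : T * bool := (a.1, ~~ a.2).

Definition reduced w := sorted (fun a b => b != linv a) w.

Record freeg := Freeg { fword : seq (T * bool); _ : reduced fword }.

HB.instance Definition _ := [isSub for fword].
HB.instance Definition _ := [Choice of freeg by <:].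

Definition lpush a w :=
  if w is b :: w' then if b == linv a then w' else a :: w else [:: a].

Definition wmul w1 w2 := foldr lpush w2 w1.
Definition winv w := rev (map linv w).

Lemma linvK : involutive linv.
Proof. by case=> x b; rewrite /linv /= negbK. Qed.

Lemma lpush_reduced a w : reduced w -> reduced (lpush a w).
Proof.
case: w => [|b w] //= rw; case: ifPn => [_|nba]; last by rewrite /= nba.
exact: path_sorted rw.
Qed.

Lemma wmul_reduced w1 w2 : reduced w2 -> reduced (wmul w1 w2).
Proof. by move=> rw; elim: w1 => //= a w1; exact: lpush_reduced. Qed.

Lemma lpushK a w : reduced w -> lpush (linv a) (lpush a w) = w.
Proof.
case: w => [|b [|c w]] /=; rewrite ?linvK ?eqxx //.
  by case: ifPn => [/eqP->|] //=; rewrite linvK eqxx.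
case/andP=> ncb _; case: ifPn => [/eqP eb|] /=; last by rewrite linvK eqxx.
by rewrite linvK; move: ncb; rewrite eb linvK => /negPf ->.
Qed.

Lemma lpushVK a w : reduced w -> lpush a (lpush (linv a) w) = w.
Proof. by move=> rw; rewrite -{1}(linvK a) lpushK. Qed.

Lemma wmul_lpush a w1 w2 : reduced w1 -> reduced w2 ->
  wmul (lpush a w1) w2 = lpush a (wmul w1 w2).
Proof.
case: w1 => [|b w1] //= rw1 rw2; case: ifPn => [/eqP->|] //.
by rewrite lpushVK ?wmul_reduced.
Qed.

Lemma wmulA_subproof w1 w2 w3 : reduced w2 -> reduced w3 ->
  wmul w1 (wmul w2 w3) = wmul (wmul w1 w2) w3.
Proof.
move=> r2 r3; elim: w1 => //= a w1 ->.
by rewrite wmul_lpush ?wmul_reduced.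
Qed.

Lemma wmulw1 w : reduced w -> wmul w [::] = w.
Proof.
elim: w => // a w IHw rw; rewrite /= IHw; last exact: path_sorted rw.
by case: w rw {IHw} => [|b w] //= /andP[/negPf->].
Qed.

Lemma wmul_cat w1 w2 w3 : wmul (w1 ++ w2) w3 = wmul w1 (wmul w2 w3).
Proof. exact: foldr_cat. Qed.

Lemma winvK : involutive winv.
Proof. by move=> w; rewrite /winv map_rev revK -map_comp map_id_in// => ? _; apply: linvK. Qed.

Lemma winv_reduced w : reduced w -> reduced (winv w).
Proof.
rewrite /reduced /winv rev_sorted sorted_map; apply: sub_sorted => a b /=.
by apply: contraNneq => /(can_inj linvK) ->; rewrite linvK.
Qed.

Lemma wmulVK w u : reduced u -> wmul (winv w) (wmul w u) = u.
Proof.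
elim: w u => [|a w IHw] u ru //=.
rewrite /winv /= rev_cons -cats1 wmul_cat /=.
by rewrite lpushK ?wmul_reduced// IHw.
Qed.

Definition fgone := @Freeg [::] isT.
Definition fgmul (g h : freeg) := Freeg (wmul_reduced (fword g) (valP h)).
Definition fginv (g : freeg) := Freeg (winv_reduced (valP g)).
Definition fgen (x : T) := @Freeg [:: (x, false)] isT.

Lemma fgmulA : associative fgmul.
Proof. by move=> g h k; apply: val_inj; rewrite /= wmulA_subproof ?(valP h) ?(valP k). Qed.

Lemma fgmul1g : left_id fgone fgmul.
Proof. by move=> g; apply: val_inj. Qed.

Lemma fgmulg1 : right_id fgone fgmul.
Proof. by move=> g; apply: val_inj; exact: wmulw1 (valP g). Qed.

Lemma fgmulVg : left_inverse fgone fginv fgmul.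
Proof.
move=> g; apply: val_inj => /=.
by rewrite -[X in wmul _ X](wmulw1 (valP g)) wmulVK.
Qed.

Lemma fgmulgV : right_inverse fgone fginv fgmul.
Proof.
move=> g; apply: val_inj => /=; rewrite -{1}[val g]winvK.
by rewrite -[X in wmul _ X](wmulw1 (winv_reduced (valP g))) wmulVK.
Qed.

HB.instance Definition _ :=
  isGroup.Build freeg fgmulA fgmul1g fgmulg1 fgmulVg fgmulgV.

End FreeGroup.

Definition zexpg (G : groupType) (x : G) (n : int) : G :=
  match n with
  | Posz k => (x ^+ k)%g
  | Negz k => (x ^- k.+1)%g
  end.

Section NormalClosure.
Local Open Scope classical_set_scope.
Local Open Scope group_scope.
Variable G : groupType.

Definition normal_subgroup (N : set G) :=
  [/\ N 1, forall x y, N x -> N y -> N (x * y),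
      forall x, N x -> N x^-1 & forall x y, N x -> N (x ^ y)].

Definition normal_closure (S : set G) : set G := smallest normal_subgroup S.

End NormalClosure.

(* Every element of [V] is a vertex; the empty set is not counted as a simplex. *)
Record complex (V : finType) := Complex {
  simplices : {set {set V}};
  simplex_neq0 : forall s, s \in simplices -> s != finset.set0;
  simplex_sub : forall s t, s \in simplices -> t != finset.set0 -> t \subset s ->
    t \in simplices;
  simplex1 : forall v : V, [set v]%SET \in simplices
}.

Section Cycles.
Variables (V : finType) (D : complex V).

Definition flag := forall s : {set V}, s != finset.set0 ->
  (forall u v, u \in s -> v \in s -> u != v -> [set u; v]%SET \in simplices D) ->
  s \in simplices D.

Definition is_dedge (e : V * V) :=
  (e.1 != e.2) && ([set e.1; e.2]%SET \in simplices D).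

Definition dedge := {e : V * V | is_dedge e}.

Definition iota_ (e : dedge) : V := (val e).1.
Definition tau_ (e : dedge) : V := (val e).2.

Definition dcycle (c : seq dedge) :=
  (c != [::]) && cycle (fun e f => tau_ e == iota_ f) c.

Definition relator (c : seq dedge) (n : int) : freeg dedge :=
  (\prod_(e <- c) zexpg (fgen e) n)%g.

End Cycles.

(* The space is a subset X of an ambient topological space T, and only the
   values of a path on [0, 1] matter. *)
Section Paths.
Local Open Scope classical_set_scope.
Variables (R : realType) (T : topologicalType) (X : set T).
Implicit Types (x y z : T) (p q : R -> T) (H : R * R -> T).

Local Notation I := (`[0, 1] : set R).

Definition is_path x y p :=
  [/\ {within I, continuous p}, p @` I `<=` X, p 0 = x & p 1 = y].

Definition is_homotopy p q H :=
  [/\ {within I `*` I, continuous H}, H @` (I `*` I) `<=` X,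
      {in I, forall t, H (0, t) = p t} & {in I, forall t, H (1, t) = q t}].

Definition path_homotopic p q := exists2 H, is_homotopy p q H &
  {in I, forall s, H (s, 0) = p 0 /\ H (s, 1) = p 1}.

Definition freely_homotopic p q := exists2 H, is_homotopy p q H &
  {in I, forall s, H (s, 0) = H (s, 1)}.

Definition pcat p q : R -> T :=
  fun t => if t <= 2^-1 then p (2 * t) else q (2 * t - 1).

Definition prev p : R -> T := fun t => p (1 - t).

Lemma within_comp {U S : topologicalType} (A : set U) (B : set S)
    (f : U -> S) (g : S -> T) :
  {within A, continuous f} -> {within B, continuous g} ->
  (forall u, A u -> B (f u)) -> {within A, continuous (g \o f)}.
Proof.
move=> /subspace_continuousP cf /subspace_continuousP cg fAB.
apply/subspace_continuousP => u Au W /(cg _ (fAB _ Au)) gW.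
have : nbhs u [set v | A v -> B (f v) -> W (g (f v))] := cf u Au _ gW.
by apply: filterS => v h Av; exact: h Av (fAB _ Av).
Qed.

Lemma within_glue {U : topologicalType} (A B C : set U) (f g h : U -> T) :
  closed A -> closed B -> C `<=` A `|` B ->
  {within A `&` C, continuous f} -> {within B `&` C, continuous g} -> closed C ->
  {in A `&` C, f =1 h} -> {in B `&` C, g =1 h} -> {within C, continuous h}.
Proof.
move=> cA cB CAB cf cg cC fh gh.
have -> : C = (A `&` C) `|` (B `&` C) by rewrite -setIUl; apply/esym/setIidr.
apply: withinU_continuous; [exact: closedI|exact: closedI| |].
- exact: subspace_eq_continuous fh cf.
- exact: subspace_eq_continuous gh cg.
Qed.

Lemma IE (t : R) : I t = (0 <= t <= 1) :> Prop.
Proof. by rewrite /= in_itv. Qed.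

Lemma sqE (u : R * R) :
  (I `*` I) u = ((0 <= u.1 <= 1) && (0 <= u.2 <= 1)) :> Prop.
Proof.
case: u => s t; rewrite propeqE; split=> [[/=]|/andP[? ?]].
  by rewrite !in_itv /= => -> ->.
by split; rewrite /= in_itv.
Qed.

Lemma I_in (t : R) : 0 <= t <= 1 -> t \in I.
Proof. by move=> h; rewrite inE IE. Qed.

Lemma closed_fst (A : set R) : closed A -> closed [set u : R * R | A u.1].
Proof. by move=> cA; apply: (@closed_comp _ _ fst) => // u _; exact: cvg_fst. Qed.

Lemma closed_snd (A : set R) : closed A -> closed [set u : R * R | A u.2].
Proof. by move=> cA; apply: (@closed_comp _ _ snd) => // u _; exact: cvg_snd. Qed.

Lemma closed_square : closed (I `*` I).
Proof.
by apply: closedI; [apply: closed_fst|apply: closed_snd]; exact: interval_closed.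
Qed.


Lemma half_lt1 : (1 <= 2^-1 :> R) = false.
Proof. by apply/negbTE; rewrite -ltNge; lra. Qed.

Lemma half_ge0 : (0 <= 2^-1 :> R).
Proof. lra. Qed.

Lemma two_sub1 : 2 - 1 = 1 :> R.
Proof. lra. Qed.

Lemma continuous_pair (U : topologicalType) (f g : U -> R) :
  continuous f -> continuous g -> continuous (fun u => (f u, g u)).
Proof.
move=> cf cg u; apply: (@cvg_pair _ _ _ (nbhs u) (nbhs (f u)) (nbhs (g u))).
- exact: cf.
- exact: cg.
Qed.

Lemma fst_cont : continuous (fst : R * R -> R).
Proof. by move=> u; exact: cvg_fst. Qed.

Lemma snd_cont : continuous (snd : R * R -> R).
Proof. by move=> u; exact: cvg_snd. Qed.

Lemma max_cont (f g : R -> R) : continuous f -> continuous g ->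
  continuous (fun t => Num.max (f t) (g t)).
Proof. by move=> cf cg t; apply: (@continuous_max R R f g t); [exact: cf|exact: cg]. Qed.

Lemma min_cont (f g : R -> R) : continuous f -> continuous g ->
  continuous (fun t => Num.min (f t) (g t)).
Proof. by move=> cf cg t; apply: (@continuous_min R R f g t); [exact: cf|exact: cg]. Qed.

Lemma add_cont (f g : R -> R) : continuous f -> continuous g ->
  continuous (fun t => f t + g t).
Proof. by move=> cf cg t; apply: cvgD; [exact: cf|exact: cg]. Qed.

Lemma scale_cont (a : R) : continuous (fun t => a * t).
Proof. exact: mulrl_continuous. Qed.

Lemma cst_cont (a : R) : continuous (fun _ : R => a).
Proof. exact: cst_continuous. Qed.

Lemma id_cont : continuous (fun t : R => t).
Proof. by move=> t; exact: cvg_id. Qed.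

Lemma cst_is_path x : X x -> is_path x x (cst x).
Proof.
by move=> Xx; split => // [|_ [t _ <-]] //; apply: continuous_subspaceT; exact: cst_continuous.
Qed.

Lemma prev_is_path x y p : is_path x y p -> is_path y x (prev p).
Proof.
case=> cp pX p0 p1; split.
- apply: (within_comp (B := I) _ cp).
    by apply: continuous_subspaceT => t; apply: cvgB; [exact: cvg_cst|exact: cvg_id].
  by move=> t; rewrite !IE => ?; lra.
- by move=> _ [t It <-]; apply: pX; exists (1 - t) => //; move: It; rewrite !IE; lra.
- by rewrite /prev subr0.
- by rewrite /prev subrr.
Qed.

Lemma pcat_is_path x y z p q :
  is_path x y p -> is_path y z q -> is_path x z (pcat p q).
Proof.
move=> [cp pX p0 p1] [cq qX q0 q1]; split.
- apply: (@within_glue R `]-oo, 2^-1] `[2^-1, +oo[ I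
      (p \o (fun t => 2 * t)) (q \o (fun t => 2 * t - 1))).
  + exact: interval_closed.
  + exact: interval_closed.
  + by move=> t _ /=; rewrite !in_itv /= andbT; case: (leP t 2^-1) => ht;
      [left|right; exact: ltW].
  + apply: (within_comp (B := I) _ cp).
      by apply: continuous_subspaceT; exact: mulrl_continuous.
    by move=> t [/=]; rewrite !in_itv /= => ? ?; lra.
  + apply: (within_comp (B := I) _ cq).
      apply: continuous_subspaceT => t; apply: cvgB; last exact: cvg_cst.
      exact: mulrl_continuous.
    by move=> t [/=]; rewrite !in_itv /= => ? ?; lra.
  + exact: interval_closed.
  + by move=> t; rewrite inE /= !in_itv /= /pcat => -[-> _].
  + move=> t; rewrite inE /= !in_itv /= /pcat andbT => -[ht _].
    case: ifPn => // h; have -> : t = 2^-1 by lra.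
    by rewrite divff // subrr p1 q0.
- move=> _ [t + <-]; rewrite IE /pcat => It; case: ifPn => h.
    by apply: pX; exists (2 * t) => //; rewrite IE; lra.
  by apply: qX; exists (2 * t - 1) => //; rewrite IE; lra.
- by rewrite /pcat half_ge0 mulr0.
- by rewrite /pcat half_lt1 mulr1 two_sub1.
Qed.

Lemma reparam x y p (f g : R -> R) : is_path x y p ->
  continuous f -> continuous g ->
  {in I, forall t, I (f t)} -> {in I, forall t, I (g t)} ->
  f 0 = g 0 -> f 1 = g 1 -> path_homotopic (p \o f) (p \o g).
Proof.
move=> [cp pX _ _] cf cg fI gI fg0 fg1.
pose k (u : R * R) := (1 - u.1) * f u.2 + u.1 * g u.2.
have kI u : (I `*` I) u -> I (k u).
  case: u => s t [/= + It]; have := fI t (mem_set It); have := gI t (mem_set It).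
  by rewrite /k /= !in_itv /= => /andP[? ?] /andP[? ?] /andP[? ?]; apply/andP; split; nra.
exists (p \o k); last first.
  by move=> s _; rewrite /= /k /= -fg0 -fg1 -!mulrDl subrK !mul1r.
split.
- apply: (within_comp (B := I) _ cp) => //; apply: continuous_subspaceT => u.
  apply: cvgD; apply: cvgM.
  + by apply: cvgB; [exact: cvg_cst|exact: fst_cont].
  + by apply: (@continuous_comp _ _ _ snd f); [exact: snd_cont|exact: cf].
  + exact: fst_cont.
  + by apply: (@continuous_comp _ _ _ snd g); [exact: snd_cont|exact: cg].
- by move=> _ [u /kI Iu <-]; apply: pX; exists (k u).
- by move=> t _; rewrite /= /k /= subr0 mul1r mul0r addr0.
- by move=> t _; rewrite /= /k /= subrr mul1r mul0r add0r.
Qed.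

Lemma path_homotopic_eql p p' q : {in I, p =1 p'} ->
  path_homotopic p q -> path_homotopic p' q.
Proof.
move=> e [H [cH HX H0 H1] Hs]; exists H; first by split=> // t It; rewrite H0 // e.
by move=> s /Hs; rewrite !e ?I_in ?lexx ?ler01.
Qed.

Lemma path_homotopic_eqr p q q' : {in I, q =1 q'} ->
  path_homotopic p q -> path_homotopic p q'.
Proof.
by move=> e [H [cH HX H0 H1] Hs]; exists H; first by split=> // t It; rewrite H1 // e.
Qed.

Lemma path_homotopic_refl x y p : is_path x y p -> path_homotopic p p.
Proof.
move=> pp; apply: (@path_homotopic_eql (p \o id)) => //.
by apply: path_homotopic_eqr (_ : {in I, p \o id =1 p}) (reparam pp _ _ _ _ _ _) => //;
  move=> t; rewrite ?inE.
Qed.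

Lemma path_homotopic_sym p q : path_homotopic p q -> path_homotopic q p.
Proof.
move=> [H [cH HX H0 H1] Hs].
have I0 : (0 : R) \in I by rewrite I_in ?lexx ?ler01.
have I1 : (1 : R) \in I by rewrite I_in ?lexx ?ler01.
exists (fun u => H (1 - u.1, u.2)); last first.
  move=> s; rewrite inE IE => ? /=; have [e0 e1] := Hs 1 I1.
  by rewrite -!H1 // e0 e1; apply: Hs; rewrite I_in //; lra.
split.
- apply: (within_comp (f := fun u : R * R => (1 - u.1, u.2)) _ cH).
    apply: continuous_subspaceT; apply: continuous_pair; last exact: snd_cont.
    by move=> u; apply: cvgB; [exact: cvg_cst|exact: fst_cont].
  by move=> [s t]; rewrite !sqE /= => ?; lra.
- move=> _ [[s t] + <-]; rewrite sqE /= => ?; apply: HX.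
  by exists (1 - s, t) => //; rewrite sqE /=; lra.
- by move=> t It; rewrite /= subr0 H1.
- by move=> t It; rewrite /= subrr H0.
Qed.

Lemma path_homotopic_trans p q r :
  path_homotopic p q -> path_homotopic q r -> path_homotopic p r.
Proof.
move=> [H [cH HX H0 H1] Hs] [K [cK KX K0 K1] Ks].
have I0 : (0 : R) \in I by rewrite I_in ?lexx ?ler01.
have I1 : (1 : R) \in I by rewrite I_in ?lexx ?ler01.
have pq0 : p 0 = q 0 by have [<- _] := Hs 1 I1; rewrite H1.
have pq1 : p 1 = q 1 by have [_ <-] := Hs 1 I1; rewrite H1.
pose h (u : R * R) := (2 * u.1, u.2); pose k (u : R * R) := (2 * u.1 - 1, u.2).
exists (fun u => if u.1 <= 2^-1 then H (h u) else K (k u)); last first.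
  move=> s; rewrite inE IE /h /k /= => Is; case: ifPn => hs.
    by apply: Hs; rewrite I_in //; lra.
  by rewrite pq0 pq1; apply: Ks; rewrite I_in //; lra.
split.
- apply: (@within_glue (R * R)%type [set u : R * R | `]-oo, 2^-1] u.1]
      [set u : R * R | `[2^-1, +oo[ u.1] (I `*` I) (H \o h) (K \o k)).
  + by apply: closed_fst; exact: interval_closed.
  + by apply: closed_fst; exact: interval_closed.
  + by move=> t _ /=; rewrite !in_itv /= andbT; case: (leP t.1 2^-1) => ht;
      [left|right; exact: ltW].
  + apply: (within_comp (f := h) _ cH).
      apply: continuous_subspaceT; apply: continuous_pair; last exact: snd_cont.
      by move=> u; apply: cvgM; [exact: cvg_cst|exact: fst_cont].
    by move=> [s t] [+]; rewrite !sqE /= in_itv /= => ? ?; lra.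
  + apply: (within_comp (f := k) _ cK).
      apply: continuous_subspaceT; apply: continuous_pair; last exact: snd_cont.
      move=> u; apply: cvgB; last exact: cvg_cst.
      by apply: cvgM; [exact: cvg_cst|exact: fst_cont].
    by move=> [s t] [+]; rewrite !sqE /= in_itv /= => ? ?; lra.
  + exact: closed_square.
  + by move=> [s t]; rewrite inE /= => -[]; rewrite in_itv /= => ->.
  + move=> [s t]; rewrite inE /= => -[]; rewrite in_itv /= andbT => hs [_ It].
    case: ifPn => // h'; have -> : s = 2^-1 by lra.
    by rewrite /h /k /= divff // subrr H1 ?K0 ?inE.
- move=> _ [[s t] + <-]; rewrite sqE /= => ?; case: ifPn => hs.
    by apply: HX; exists (h (s, t)) => //; rewrite sqE /=; lra.
  by apply: KX; exists (k (s, t)) => //; rewrite sqE /=; lra.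
- by move=> t It; rewrite /h /= half_ge0 mulr0 H0.
- by move=> t It; rewrite /k /= half_lt1 mulr1 two_sub1 K1.
Qed.

Lemma path_homotopic_cat x y z p p' q q' :
  is_path x y p -> is_path y z q ->
  path_homotopic p p' -> path_homotopic q q' ->
  path_homotopic (pcat p q) (pcat p' q').
Proof.
move=> [_ _ _ p1] [_ _ q0 _] [H [cH HX H0 H1] Hs] [K [cK KX K0 K1] Ks].
pose h (u : R * R) := (u.1, 2 * u.2); pose k (u : R * R) := (u.1, 2 * u.2 - 1).
exists (fun u => if u.2 <= 2^-1 then H (h u) else K (k u)); last first.
  move=> s Is; rewrite /h /k /pcat /= !mulr0 !mulr1 half_ge0 half_lt1 two_sub1.
  by have [-> _] := Hs s Is; have [_ ->] := Ks s Is.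
split.
- apply: (@within_glue (R * R)%type [set u : R * R | `]-oo, 2^-1] u.2]
      [set u : R * R | `[2^-1, +oo[ u.2] (I `*` I) (H \o h) (K \o k)).
  + by apply: closed_snd; exact: interval_closed.
  + by apply: closed_snd; exact: interval_closed.
  + by move=> t _ /=; rewrite !in_itv /= andbT; case: (leP t.2 2^-1) => ht;
      [left|right; exact: ltW].
  + apply: (within_comp (f := h) _ cH).
      apply: continuous_subspaceT; apply: continuous_pair; first exact: fst_cont.
      by move=> u; apply: cvgM; [exact: cvg_cst|exact: snd_cont].
    by move=> [s t] [+]; rewrite !sqE /= in_itv /= => ? ?; lra.
  + apply: (within_comp (f := k) _ cK).
      apply: continuous_subspaceT; apply: continuous_pair; first exact: fst_cont.
      move=> u; apply: cvgB; last exact: cvg_cst.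
      by apply: cvgM; [exact: cvg_cst|exact: snd_cont].
    by move=> [s t] [+]; rewrite !sqE /= in_itv /= => ? ?; lra.
  + exact: closed_square.
  + by move=> [s t]; rewrite inE /= => -[]; rewrite in_itv /= => ->.
  + move=> [s t]; rewrite inE /= => -[]; rewrite in_itv /= andbT => ht [Is _].
    case: ifPn => // h'; have -> : t = 2^-1 by lra.
    rewrite /h /k /= divff // subrr.
    have [|_ ->] := Hs s; first by rewrite inE.
    have [|-> _] := Ks s; first by rewrite inE.
    by rewrite p1 q0.
- move=> _ [[s t] + <-]; rewrite sqE /= => ?; case: ifPn => hs.
    by apply: HX; exists (h (s, t)) => //; rewrite sqE /=; lra.
  by apply: KX; exists (k (s, t)) => //; rewrite sqE /=; lra.
- move=> t; rewrite inE IE /h /k /pcat /= => It.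
  by case: ifPn => ht; rewrite ?H0 ?K0 // I_in //; lra.
- move=> t; rewrite inE IE /h /k /pcat /= => It.
  by case: ifPn => ht; rewrite ?H1 ?K1 // I_in //; lra.
Qed.

Lemma path_homotopic_rev p p' :
  path_homotopic p p' -> path_homotopic (prev p) (prev p').
Proof.
move=> [H [cH HX H0 H1] Hs].
exists (fun u => H (u.1, 1 - u.2)); last first.
  by move=> s /Hs[h0 h1]; rewrite /prev /= subr0 subrr.
split.
- apply: (within_comp (f := fun u : R * R => (u.1, 1 - u.2)) _ cH).
    apply: continuous_subspaceT; apply: continuous_pair; first exact: fst_cont.
    by move=> u; apply: cvgB; [exact: cvg_cst|exact: snd_cont].
  by move=> [s t]; rewrite !sqE /= => ?; lra.
- move=> _ [[s t] + <-]; rewrite sqE /= => ?; apply: HX.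
  by exists (s, 1 - t) => //; rewrite sqE /=; lra.
- by move=> t; rewrite inE IE => ?; rewrite /prev /= H0 // I_in //; lra.
- by move=> t; rewrite inE IE => ?; rewrite /prev /= H1 // I_in //; lra.
Qed.

Lemma pcat_cstl x y p : is_path x y p -> path_homotopic (pcat (cst x) p) p.
Proof.
move=> pp; have [_ _ p0 _] := pp.
apply: (@path_homotopic_eql (p \o (fun t => Num.max 0 (2 * t - 1)))).
  move=> t _; rewrite /= /pcat; case: ifPn => ht.
    by rewrite max_l ?p0 //; lra.
  by rewrite max_r //; lra.
apply: (@path_homotopic_eqr _ (p \o id)) => //; apply: (reparam pp).
- by apply: max_cont; [exact: cst_cont|apply: add_cont; [exact: scale_cont|exact: cst_cont]].
- exact: id_cont.
- by move=> t; rewrite inE !IE => ?; rewrite le_max lexx ge_max /=; lra.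
- by move=> t; rewrite inE.
- by rewrite mulr0 max_l //; lra.
- by rewrite max_r; lra.
Qed.

Lemma pcat_prevl x y p : is_path x y p -> path_homotopic (pcat (prev p) p) (cst y).
Proof.
move=> pp; have [_ _ _ p1] := pp.
apply: (@path_homotopic_eql (p \o (fun t => Num.max (1 - 2 * t) (2 * t - 1)))).
  move=> t _; rewrite /= /pcat /prev; case: ifPn => ht.
    by rewrite max_l //; lra.
  by rewrite max_r //; lra.
apply: (@path_homotopic_eqr _ (p \o (fun=> 1))) => [t _ /=|]; first exact: p1.
apply: (reparam pp).
- apply: max_cont; last by apply: add_cont; [exact: scale_cont|exact: cst_cont].
  by apply: add_cont; [exact: cst_cont|move=> t; apply: cvgN; exact: scale_cont].
- exact: cst_cont.
- by move=> t; rewrite inE !IE => ?; rewrite le_max ge_max; lra.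
- by move=> t _; rewrite IE lexx ler01.
- by rewrite mulr0 max_l //; lra.
- by rewrite max_r; lra.
Qed.

Lemma pcat_prevr x y p : is_path x y p -> path_homotopic (pcat p (prev p)) (cst x).
Proof.
move=> pp; apply: path_homotopic_eql (pcat_prevl (prev_is_path pp)) => t _.
by rewrite /pcat /prev !opprB addrCA subrr addr0.
Qed.

Lemma pcat_cstr x y p : is_path x y p -> path_homotopic (pcat p (cst y)) p.
Proof.
move=> pp; have [_ _ _ p1] := pp.
apply: (@path_homotopic_eql (p \o (fun t => Num.min (2 * t) 1))).
  move=> t _; rewrite /= /pcat; case: ifPn => ht.
    by rewrite min_l //; lra.
  by rewrite min_r ?p1 //; lra.
apply: (@path_homotopic_eqr _ (p \o id)) => //; apply: (reparam pp).
- by apply: min_cont; [exact: scale_cont|exact: cst_cont].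
- exact: id_cont.
- by move=> t; rewrite inE !IE => ?; rewrite le_min ge_min; lra.
- by move=> t; rewrite inE.
- by rewrite mulr0 min_l //; lra.
- by rewrite min_r; lra.
Qed.

Lemma pcatA_homotopic x y z w p q r :
  is_path x y p -> is_path y z q -> is_path z w r ->
  path_homotopic (pcat p (pcat q r)) (pcat (pcat p q) r).
Proof.
move=> pp pq pr; apply: path_homotopic_sym.
have pc := pcat_is_path pp (pcat_is_path pq pr).
pose f (t : R) := Num.min (2 * t) (Num.min (t + 4^-1) (2^-1 * t + 2^-1)).
apply: (@path_homotopic_eql (pcat p (pcat q r) \o f)).
  move=> t; rewrite inE IE => It; rewrite /= /pcat /f; case: (leP t 2^-1) => h1.
    rewrite (@min_l _ _ (t + _)); last by lra.
    case: (leP (2 * t) 2^-1) => h2.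
      by rewrite min_l; [rewrite h2|lra].
    rewrite min_r; last by lra.
    rewrite ifF; last by lra.
    by rewrite ifT; [congr q|]; lra.
  rewrite (@min_r _ _ (t + _)); last by lra.
  rewrite min_r; last by lra.
  rewrite ifF; last by lra.
  by rewrite ifF; [congr r|]; lra.
apply: (@path_homotopic_eqr _ (pcat p (pcat q r) \o id)) => //; apply: (reparam pc).
- apply: min_cont; first exact: scale_cont.
  apply: min_cont; apply: add_cont; [exact: id_cont|exact: cst_cont|exact: scale_cont|exact: cst_cont].
- exact: id_cont.
- by move=> t; rewrite inE !IE /f => ?; rewrite !le_min !ge_min; lra.
- by move=> t; rewrite inE.
- by rewrite /f min_l ?mulr0 // le_min; lra.
- by rewrite /f (@min_r _ _ (1 + _)) ?min_r; lra.
Qed.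

End Paths.

Section Pi1.
Local Open Scope classical_set_scope.
Local Open Scope quotient_scope.
Variables (R : realType) (T : topologicalType) (X : set T) (x0 : X).

Record loop := Loop {
  loop_fun :> R -> T;
  loopP : is_path X (val x0) (val x0) loop_fun
}.

HB.instance Definition _ := gen_eqMixin loop.
HB.instance Definition _ := gen_choiceMixin loop.

Definition loop_eq (p q : loop) : bool := `[< path_homotopic X p q >].

Lemma loop_eq_refl : reflexive loop_eq.
Proof. by move=> p; apply/asboolP; exact: path_homotopic_refl (loopP p). Qed.

Lemma loop_eq_sym : symmetric loop_eq.
Proof. by move=> p q; apply/asboolP/asboolP; exact: path_homotopic_sym. Qed.

Lemma loop_eq_trans : transitive loop_eq.
Proof.
by move=> q p r /asboolP pq /asboolP qr; apply/asboolP; exact: path_homotopic_trans qr.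
Qed.

Canonical loop_equiv := EquivRel loop_eq loop_eq_refl loop_eq_sym loop_eq_trans.

Definition pi1 := {eq_quot loop_equiv}.

HB.instance Definition _ := Choice.on pi1.

Definition loop_one := Loop (cst_is_path R (set_mem (valP x0))).
Definition loop_mul (p q : loop) := Loop (pcat_is_path (loopP p) (loopP q)).
Definition loop_inv (p : loop) := Loop (prev_is_path (loopP p)).

Definition pi1_one : pi1 := \pi_pi1 loop_one.
Definition pi1_mul (a b : pi1) : pi1 := \pi_pi1 (loop_mul (repr a) (repr b)).
Definition pi1_inv (a : pi1) : pi1 := \pi_pi1 (loop_inv (repr a)).

Lemma pi1_eqP (p q : loop) :
  \pi_pi1 p = \pi_pi1 q <-> path_homotopic X p q.
Proof. by split => [/eqmodP/asboolP//|h]; apply/eqmodP/asboolP. Qed.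

Lemma repr_pi1 (p : loop) : path_homotopic X (repr (\pi_pi1 p)) p.
Proof. by apply/pi1_eqP; rewrite reprK. Qed.

Lemma pi1_mulE (p q : loop) :
  pi1_mul (\pi_pi1 p) (\pi_pi1 q) = \pi_pi1 (loop_mul p q).
Proof.
by apply/pi1_eqP; apply: path_homotopic_cat (repr_pi1 p) (repr_pi1 q); exact: loopP.
Qed.

Lemma pi1_invE (p : loop) : pi1_inv (\pi_pi1 p) = \pi_pi1 (loop_inv p).
Proof. by apply/pi1_eqP; exact: path_homotopic_rev (repr_pi1 p). Qed.

Lemma pi1_mulA : associative pi1_mul.
Proof.
elim/quotW => p; elim/quotW => q; elim/quotW => r.
rewrite (pi1_mulE q r) (pi1_mulE p q) (pi1_mulE p) (pi1_mulE _ r).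
apply/pi1_eqP; exact: (pcatA_homotopic (loopP p) (loopP q) (loopP r)).
Qed.

Lemma pi1_mul1 : left_id pi1_one pi1_mul.
Proof. by elim/quotW => p; rewrite pi1_mulE; apply/pi1_eqP/(pcat_cstl (loopP p)). Qed.

Lemma pi1_mulr1 : right_id pi1_one pi1_mul.
Proof. by elim/quotW => p; rewrite pi1_mulE; apply/pi1_eqP/(pcat_cstr (loopP p)). Qed.

Lemma pi1_mulV : left_inverse pi1_one pi1_inv pi1_mul.
Proof.
by elim/quotW => p; rewrite pi1_invE pi1_mulE; apply/pi1_eqP/(pcat_prevl (loopP p)).
Qed.

Lemma pi1_mulrV : right_inverse pi1_one pi1_inv pi1_mul.
Proof.
by elim/quotW => p; rewrite pi1_invE pi1_mulE; apply/pi1_eqP/(pcat_prevr (loopP p)).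
Qed.

HB.instance Definition _ :=
  isGroup.Build pi1 pi1_mulA pi1_mul1 pi1_mulr1 pi1_mulV pi1_mulrV.

(* For X path connected this is a single conjugacy class, whatever the base
   point of the closed path p. *)
Definition free_class (p : R -> T) : set pi1 :=
  [set a | exists2 q : loop, a = \pi_pi1 q & freely_homotopic X q p].

End Pi1.

Arguments free_class {R T X} x0 p.

Section Realization.
Local Open Scope classical_set_scope.
Variables (R : realType) (V : finType) (D : complex V).

(* The points are given by their barycentric coordinates. *)
Definition realization : set {ptws V -> R} :=
  [set x | [/\ forall v, 0 <= x v, \sum_v x v = 1 &
               finset (fun v => x v != 0) \in simplices D]].

Definition edge_path (e : dedge D) : R -> {ptws V -> R} :=
  fun t v => (1 - t) * (v == iota_ e)%:R + t * (v == tau_ e)%:R.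

Fixpoint edges_path (e : dedge D) (c : seq (dedge D)) : R -> {ptws V -> R} :=
  if c is f :: c' then pcat (edge_path e) (edges_path f c') else edge_path e.

(* The value on the empty sequence is irrelevant. *)
Definition cycle_path (c : seq (dedge D)) : R -> {ptws V -> R} :=
  if c is e :: c' then edges_path e c' else fun _ _ => 0.

Definition cycle_class (x0 : realization) (c : seq (dedge D)) :
  set (pi1 R x0) := free_class x0 (cycle_path c).

End Realization.

Arguments realization R {V} D.
Arguments edge_path R {V D} e.
Arguments edges_path R {V D} e c.
Arguments cycle_path R {V D} c.
Arguments cycle_class {R V D} x0 c.

Section Relators.
Local Open Scope classical_set_scope.
Variables (V : finType) (D : complex V).

Definition short_relators : set (freeg (dedge D)) :=
  [set r | exists2 d, dcycle d & size d = 2%N /\ r = relator d 1] `|`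
  [set r | exists2 d, dcycle d &
             size d = 3%N /\ (r = relator d 1 \/ r = relator d (-1))].

Definition power_relators m (c : 'I_m -> seq (dedge D)) :
    set (freeg (dedge D)) :=
  [set r | exists (i : 'I_m) (n : int), n != 0 /\ r = relator (c i) n].

End Relators.

Arguments short_relators {V} D _.

(* Main.v *)
(* Fix n. Modulo the given relators, [u, v] |-> (the class of the edge (u, v))^n
   is a 1-cocycle: by (a) and (b) it is multiplicative on every simplex. It thus
   defines a flat bundle over the realization, trivialised over the open star
   of each vertex, and the monodromy of this bundle along the closed path of a
   directed cycle c is the class of c^[n]. Closed paths with trivial monodromy
   are stable under free homotopy, and their classes form a normal subgroup of
   pi_1; it contains the c_i, hence is everything, so c^[n] is trivial. *)
From HB Require Import structures.
Require Import Defs.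
From mathcomp Require Import all_boot all_order all_algebra.
From mathcomp Require Import generic_quotient.
From mathcomp Require Import all_classical all_reals all_analysis.
From mathcomp Require Import lra.

Import Order.TTheory GRing.Theory Num.Theory.
Import numFieldNormedType.Exports.

Set Implicit Arguments.
Unset Strict Implicit.
Unset Printing Implicit Defensive.

Local Open Scope classical_set_scope.
Local Open Scope ring_scope.

(** * Quotient of a group by a normal subgroup *)

Section QuotientGroup.
Local Open Scope group_scope.
Local Open Scope quotient_scope.
Variables (G : groupType) (N : set G) (nN : normal_subgroup N).

Definition coset_eq (x y : G) : bool := `[< N (x^-1 * y) >].

Lemma coset_eq_refl : reflexive coset_eq.
Proof. by move=> x; apply/asboolP; rewrite mulVg; case: nN. Qed.

Lemma coset_eq_sym : symmetric coset_eq.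
Proof.
have [_ _ NV _] := nN.
by move=> x y; apply/asboolP/asboolP => /NV; rewrite invgM invgK.
Qed.

Lemma coset_eq_trans : transitive coset_eq.
Proof.
have [_ NM _ _] := nN => y x z /asboolP xy /asboolP yz; apply/asboolP.
by have := NM _ _ xy yz; rewrite -mulgA mulVKg.
Qed.

Canonical coset_equiv :=
  EquivRel coset_eq coset_eq_refl coset_eq_sym coset_eq_trans.

Definition quotg := {eq_quot coset_equiv}.

HB.instance Definition _ := Choice.on quotg.

Definition quotg_pi (x : G) : quotg := \pi_quotg x.
Definition quotg_mul (a b : quotg) : quotg := quotg_pi (repr a * repr b).
Definition quotg_inv (a : quotg) : quotg := quotg_pi (repr a)^-1.

Lemma quotg_pi_eq (x y : G) : quotg_pi x = quotg_pi y <-> N (x^-1 * y).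
Proof. by split=> [/eqmodP/asboolP//|h]; apply/eqmodP/asboolP. Qed.

(** Normality enters through [(x' * y')^-1 * (x * y) = (x'^-1 * x) ^ y' * (y'^-1 * y)], with [x']
    and [y'] the chosen representatives. *)
Lemma quotg_piM (x y : G) : quotg_mul (quotg_pi x) (quotg_pi y) = quotg_pi (x * y).
Proof.
have [_ NM _ NJ] := nN; rewrite /quotg_mul; apply/quotg_pi_eq.
have /quotg_pi_eq hx : quotg_pi (repr (quotg_pi x)) = quotg_pi x by rewrite /quotg_pi reprK.
have /quotg_pi_eq hy : quotg_pi (repr (quotg_pi y)) = quotg_pi y by rewrite /quotg_pi reprK.
move: (repr _) (repr _) hx hy => y' x' hx hy.
by have := NM _ _ (NJ _ y' hx) hy; rewrite conjgE invgM -!mulgA; rewrite mulVKg.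
Qed.

Lemma quotg_piV (x : G) : quotg_inv (quotg_pi x) = quotg_pi x^-1.
Proof.
have [_ NM NV NJ] := nN; rewrite /quotg_inv; apply/quotg_pi_eq.
have /quotg_pi_eq hx : quotg_pi (repr (quotg_pi x)) = quotg_pi x by rewrite /quotg_pi reprK.
move: (repr _) hx => x' /NV /(NJ _ x'^-1).
by rewrite conjgE invgK invgM invgK mulgK.
Qed.

Lemma quotg_mulA : associative quotg_mul.
Proof.
elim/quotW => x; elim/quotW => y; elim/quotW => z.
by rewrite -!/(quotg_pi _) !quotg_piM mulgA.
Qed.

Lemma quotg_mul1 : left_id (quotg_pi 1) quotg_mul.
Proof. by elim/quotW => x; rewrite -!/(quotg_pi _) !quotg_piM mul1g. Qed.

Lemma quotg_mulr1 : right_id (quotg_pi 1) quotg_mul.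
Proof. by elim/quotW => x; rewrite -!/(quotg_pi _) !quotg_piM mulg1. Qed.

Lemma quotg_mulV : left_inverse (quotg_pi 1) quotg_inv quotg_mul.
Proof. by elim/quotW => x; rewrite -!/(quotg_pi _) quotg_piV !quotg_piM mulVg. Qed.

Lemma quotg_mulrV : right_inverse (quotg_pi 1) quotg_inv quotg_mul.
Proof. by elim/quotW => x; rewrite -!/(quotg_pi _) quotg_piV !quotg_piM mulgV. Qed.

HB.instance Definition _ :=
  isGroup.Build quotg quotg_mulA quotg_mul1 quotg_mulr1 quotg_mulV quotg_mulrV.

HB.instance Definition _ := isGroupMorphism.Build G quotg quotg_pi
  (fun x y => etrans (congr1 quotg_pi (erefl (x * y^-1)))
     (esym (etrans (congr1 (quotg_mul _) (quotg_piV y)) (quotg_piM _ _)))).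

Lemma quotg_pi_eq1 (x : G) : quotg_pi x = 1 <-> N x.
Proof.
rewrite -[1]/(quotg_pi 1); split=> [/esym|Nx]; last apply/esym.
  by move/quotg_pi_eq; rewrite invg1 mul1g.
by apply/quotg_pi_eq; rewrite invg1 mul1g.
Qed.

End QuotientGroup.

(** * Integer powers in a group *)

Section ZExp.
Local Open Scope group_scope.

Lemma zexpgMn (G : groupType) (x y : G) n :
  commute x y -> zexpg (x * y) n = zexpg x n * zexpg y n.
Proof.
move=> cxy; case: n => n /=; rewrite expgMn //.
by rewrite (commuteX2 n.+1 n.+1 cxy) invgM.
Qed.

Lemma zexpg1n (G : groupType) n : zexpg (1 : G) n = 1.
Proof. by case: n => n; rewrite /= expg1n ?invg1. Qed.

Lemma gmulf_zexpg (G H : groupType) (f : UMagmaMorphism.type G H) (x : G) n :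
  f (zexpg x n) = zexpg (f x) n.
Proof. by case: n => n; rewrite /= (gmulfXn, gmulfXVn). Qed.

Lemma zexpg_mul_eq1 (G : groupType) (x y : G) n :
  x * y = 1 -> zexpg x n * zexpg y n = 1.
Proof.
move=> xy1; rewrite -zexpgMn ?xy1 ?zexpg1n //.
by rewrite -(mulg1_eq xy1); apply/commuteV.
Qed.

(** The hypotheses say that [x * y] and [y * x] both equal [z^-1]. Hence [x] and [y] commute, and
    powers distribute over [x * y]. *)
Lemma zexpg_mul3_eq1 (G : groupType) (x y z : G) n :
  x * y * z = 1 -> x^-1 * y^-1 * z^-1 = 1 ->
  zexpg x n * zexpg y n * zexpg z n = 1.
Proof.
move=> xyz1 h.
have yx : y * x = x * y.
  apply: invg_inj; rewrite invgM (mulg1_eq xyz1).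
  by rewrite -[LHS]invgK (mulg1_eq h) invgK.
by rewrite -(zexpgMn n (x := x)) // zexpg_mul_eq1.
Qed.

End ZExp.

(** * Normal closures *)

Section NormalClosureTheory.
Local Open Scope group_scope.
Variable G : groupType.

Lemma normal_closure_normal (S : set G) : normal_subgroup (normal_closure S).
Proof.
split=> [A [[]]//|x y Sx Sy A hA|x Sx A hA|x y Sx A hA].
- by case: (hA) => -[_ AM _ _] _; apply: AM; [exact: Sx|exact: Sy].
- by case: (hA) => -[_ _ AV _] _; apply: AV; exact: Sx.
- by case: (hA) => -[_ _ _ AJ] _; apply: AJ; exact: Sx.
Qed.

Lemma sub_normal_closure (S : set G) : S `<=` normal_closure S.
Proof. exact: sub_gen_smallest. Qed.

Lemma normal_closure_min (S N : set G) : normal_subgroup N -> S `<=` N ->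
  normal_closure S `<=` N.
Proof. exact: smallest_sub. Qed.

End NormalClosureTheory.

(** The supremum of the [x] with [P a x] is attained and cannot lie below [b]. This serves below
    both as the connectedness argument (uniqueness of sections) and as the compactness argument
    (their existence). *)
Lemma interval_induction (R : realType) (P : R -> R -> Prop) (a b : R) : a <= b ->
  (forall x y z, a <= x -> x <= y -> y <= z -> z <= b ->
     P x y -> P y z -> P x z) ->
  (forall t, a <= t <= b -> exists2 e, 0 < e & forall x y,
     a <= x -> x <= y -> y <= b -> `|x - t| < e -> `|y - t| < e -> P x y) ->
  P a b.
Proof.
move=> ab PD Ploc; pose S := [set x | a <= x <= b /\ P a x].
have Sa : S a.
  have [|e e0 Pe] := Ploc a; first by rewrite lexx ab.
  by split; [rewrite lexx ab|apply: Pe; rewrite ?subrr ?normr0].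
have ubS : has_ubound S by exists b => x [/andP[]].
have supS : has_sup S by split=> //; exists a.
have leS x : S x -> x <= sup S by apply: ub_le_sup.
have [am mb] : a <= sup S /\ sup S <= b.
  split; first exact: leS.
  by apply: ge_sup => [|x [/andP[]]//]; exists a.
have [|e e0 Pe] := Ploc (sup S); first by rewrite am mb.
have [x [/andP[ax xb] Pax] mx] := sup_adherent e0 supS.
have xm : x <= sup S by apply: leS; split; rewrite ?ax.
(* [y] lies beyond the supremum unless it is cut off at [b], and [e / 2] keeps it in the
   neighbourhood given by [Ploc]. So [S y] forces [y = b]. *)
pose y := Num.min b (sup S + e / 2).
have [yb ym] : y <= b /\ y <= sup S + e / 2 by rewrite !ge_min !lexx orbT.
have my : sup S <= y by rewrite le_min mb /=; lra.
have Sy : S y.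
  split; first by apply/andP; split; lra.
  apply: (PD a x y) => //; first exact: le_trans my.
  by apply: Pe => //; [exact: le_trans my|rewrite ltr_norml; lra|rewrite ltr_norml; lra].
have := leS y Sy; rewrite /y; case: (leP b (sup S + e / 2)) => hb.
  by move: Sy; rewrite /y min_l // => -[].
by lra.
Qed.

(** * Flat sections along paths and over rectangles *)

Section Sections.
Variables (R : realType) (V : Type) (Q : groupType) (alpha : V -> V -> Q).
Implicit Types (a b c d t : R) (p : R -> V -> R) (s : R -> V -> Q) (H : R -> R -> V -> R).
Implicit Types (S : R -> R -> V -> Q).

Definition cocycle_at (x : V -> R) := forall u v w,
  x u != 0 -> x v != 0 -> x w != 0 -> (alpha u v * alpha v w = alpha u w)%g.

(* A flat section along p, read in the charts given by the open stars
   [p t v != 0]: s changes by alpha from chart to chart and is constant in v on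
   every interval which p maps into the star of v. *)
Definition is_section p a b s :=
  (forall t v w, a <= t <= b -> p t v != 0 -> p t w != 0 ->
     s t w = s t v * alpha v w)%g /\
  (forall t u v, a <= t -> t <= u -> u <= b ->
     (forall r, t <= r <= u -> p r v != 0) -> s t v = s u v).

(** Takes the place of continuity of [p], so that no topology on [V -> R] enters here;
    [path_charted] derives it for paths. *)
Definition charted p a b := forall t, a <= t <= b ->
  exists v, exists2 e, 0 < e &
    forall u, a <= u <= b -> `|u - t| < e -> p u v != 0.

Lemma charted_neq0 p a b t : charted p a b -> a <= t <= b -> exists v, p t v != 0.
Proof.
move=> cp tab; have [v [e e0 h]] := cp t tab.
by exists v; apply: h; rewrite ?subrr ?normr0.
Qed.

Lemma section_sub p a b c d s : a <= c -> d <= b ->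
  is_section p a b s -> is_section p c d s.
Proof.
move=> ac db [s1 s2]; split=> [t v w tcd|t u v ct tu ud]; first by apply: s1; lra.
by apply: s2; lra.
Qed.

Lemma section_ext p q a b s : (forall t, a <= t <= b -> p t = q t) ->
  is_section p a b s -> is_section q a b s.
Proof.
move=> pq [s1 s2]; split=> [t v w tab|t u v at_ tu ub h]; first by rewrite -pq //; apply: s1.
by apply: s2 => // r rtu; rewrite pq ?h //; lra.
Qed.

Lemma section_mull p a b s g :
  is_section p a b s -> is_section p a b (fun t v => g * s t v)%g.
Proof.
move=> [s1 s2]; split=> [t v w tab pv pw|t u v at_ tu ub h].
  by rewrite (s1 t v w) // mulgA.
by rewrite (s2 t u v).
Qed.

Lemma section_glue p a m b s s' :
  is_section p a m s -> is_section p m b s' ->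
  (forall v, p m v != 0 -> s m v = s' m v) ->
  is_section p a b (fun t => if t <= m then s t else s' t).
Proof.
move=> [s1 s2] [s'1 s'2] ss'; split=> [t v w tab|t u v at_ tu ub h].
  by case: leP => tm; [apply: s1|apply: s'1]; lra.
case: (leP t m) => tm; case: (leP u m) => um.
- exact: s2.
(* The chart [v] covers the time [m] as well, so the value passes from [s] to [s'] there. *)
- rewrite (s2 t m v) // ?ss' ?(s'2 m u v) //; try exact: ltW.
  + by move=> r rmu; apply: h; lra.
  + by apply: h; lra.
  + by move=> r rmu; apply: h; lra.
- by exfalso; lra.
- by apply: s'2 => //; lra.
Qed.

Lemma section_affine p a b s (k l : R) : 0 < k ->
  is_section p (k * a + l) (k * b + l) s ->
  is_section (fun t => p (k * t + l)) a b (fun t => s (k * t + l)).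
Proof.
move=> k0 [s1 s2]; have mono x y : (k * x + l <= k * y + l) = (x <= y).
  by rewrite lerD2r ler_pM2l.
split=> [t v w /andP[at_ tb]|t u v at_ tu ub h].
  by apply: s1; rewrite !mono at_.
apply: s2; rewrite ?mono // => r /andP[tr ru].
have rE : r = k * (k^-1 * (r - l)) + l by rewrite mulVKf ?gt_eqF // subrK.
by rewrite rE; apply: h; rewrite -(mono t) -(mono _ u) -rE tr.
Qed.

Lemma section_rev p a b s (l : R) :
  is_section p (l - b) (l - a) s ->
  is_section (fun t => p (l - t)) a b (fun t => s (l - t)).
Proof.
move=> [s1 s2]; split=> [t v w tab|t u v at_ tu ub h]; first by apply: s1; lra.
apply/esym/s2; [lra|lra|lra|] => r rh.
by rewrite (_ : r = l - (l - r)); [apply: h; lra|lra].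
Qed.

(** A chart change multiplies [s] and [s'] on the right by the same factor, so their ratio does not
    depend on the chart. In a fixed star both are constant, so the ratio is locally constant. *)
Lemma section_uniq p a b s s' : charted p a b ->
  is_section p a b s -> is_section p a b s' ->
  forall t u v w, a <= t <= b -> a <= u <= b -> p t v != 0 -> p u w != 0 ->
  (s' t v / s t v = s' u w / s u w)%g.
Proof.
move=> cp [s1 s2] [s'1 s'2].
suff le t u v w : a <= t -> t <= u -> u <= b -> p t v != 0 -> p u w != 0 ->
    (s' t v / s t v = s' u w / s u w)%g.
  move=> t u v w ht hu pv pw; case: (leP t u) => tu; first by apply: le => //; lra.
  by apply/esym/le => //; lra.
move=> at_ tu ub; move: v w.
apply: (@interval_induction R (fun x y => forall v w, p x v != 0 -> p y w != 0 ->
  (s' x v / s x v = s' y w / s y w)%g) t u tu).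
- move=> x y z tx xy yz zu hxy hyz v w pv pw.
  have [|o po] := charted_neq0 (t := y) cp; first by lra.
  by rewrite (hxy v o) // (hyz o w).
- move=> r rtu; have [|o [e e0 h]] := cp r; first by lra.
  exists e => // x y tx xy yu xe ye v w pv pw.
  (* One chart [o] serves all of [[x, y]]; the ratio is moved to it at both ends. *)
  have po q : x <= q <= y -> p q o != 0.
    move=> qxy; apply: h; first by lra.
    by move: xe ye; rewrite !ltr_norml; lra.
  have ratio q z : x <= q <= y -> p q z != 0 -> (s' q z / s q z = s' q o / s q o)%g.
    move=> hq pz; have aqb : a <= q <= b by lra.
    by rewrite (s1 q o z) ?(s'1 q o z) ?po // invgM mulgA mulgK.
  rewrite ratio //; last by lra.
  rewrite [RHS]ratio //; last by lra.
  have [ax yb] : a <= x /\ y <= b by lra.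
  by rewrite (s2 x y o) // (s'2 x y o).
Qed.

Lemma section_uniq1 p a b s s' t v : charted p a b ->
  is_section p a b s -> is_section p a b s' -> a <= t <= b -> p t v != 0 ->
  s t v = s' t v ->
  forall u w, a <= u <= b -> p u w != 0 -> s u w = s' u w.
Proof.
move=> cp ss ss' ht pv e u w hu pw; apply/eqP; rewrite eq_sym -divg_eq1.
by rewrite (section_uniq cp ss ss' hu ht pw pv) e divg_eq1.
Qed.

Definition charted2 H a b c d := forall x y, a <= x <= b -> c <= y <= d ->
  exists v, exists2 e, 0 < e & forall x' y', a <= x' <= b -> c <= y' <= d ->
    `|x' - x| < e -> `|y' - y| < e -> H x' y' v != 0.

(** Flatness is tested on horizontal and vertical lines only: gluing and the comparison of opposite
    sides use no other lines. *)
Definition is_section2 H a b c d S :=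
  (forall x, a <= x <= b -> is_section (H x) c d (S x)) /\
  (forall y, c <= y <= d -> is_section (H^~ y) a b (S^~ y)).

Definition swap T (F : R -> R -> T) x y := F y x.

Lemma charted2_swap H a b c d : charted2 H a b c d -> charted2 (swap H) c d a b.
Proof.
move=> cH x y hx hy; have [v [e e0 h]] := cH y x hy hx.
by exists v, e => // *; apply: h.
Qed.

Lemma section2_swap H a b c d S :
  is_section2 H a b c d S -> is_section2 (swap H) c d a b (swap S).
Proof. by case. Qed.

Lemma charted2_sub H a b c d a' b' c' d' : a <= a' -> b' <= b -> c <= c' -> d' <= d ->
  charted2 H a b c d -> charted2 H a' b' c' d'.
Proof.
move=> aa bb cc dd cH x y hx hy; have [||v [e e0 h]] := cH x y; [lra|lra|].
by exists v, e => // x' y' hx' hy'; apply: h; lra.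
Qed.

Lemma charted2_col H a b c d y : charted2 H a b c d -> c <= y <= d ->
  charted (H^~ y) a b.
Proof.
move=> cH hy x hx; have [v [e e0 h]] := cH x y hx hy.
by exists v, e => // u hu ux; apply: h; rewrite ?subrr ?normr0.
Qed.

(** By uniqueness along the common side [y = m], the two sections differ there by a constant left
    factor. Multiplying [S'] by it makes them match. *)
Lemma section2_glue H a b c m d S S' : a <= b -> c <= m -> m <= d ->
  charted2 H a b c d -> is_section2 H a b c m S -> is_section2 H a b m d S' ->
  exists S'', is_section2 H a b c d S''.
Proof.
move=> ab cm md cH [r1 c1] [r2 c2].
have cHm : charted (H^~ m) a b by apply: charted2_col cH _; lra.
have [|o ho] := charted_neq0 (t := a) cHm; first by rewrite lexx.
(* The factor is read off at the corner [(a, m)]. *)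
pose k := (S a m o / S' a m o)%g.
have match_ x v : a <= x <= b -> H x m v != 0 -> S x m v = (k * S' x m v)%g.
  move=> hx hv.
  have c1m : is_section (H^~ m) a b (S^~ m) by apply: c1; rewrite cm lexx.
  have c2m : is_section (H^~ m) a b (fun t v => k * S' t m v)%g.
    by apply: section_mull; apply: c2; rewrite lexx md.
  apply: (section_uniq1 cHm c1m c2m (t := a) (v := o)) => //; first by rewrite lexx.
  by rewrite /k mulgVK.
exists (fun x y v => if y <= m then S x y v else k * S' x y v)%g; split=> [x hx|y hy].
  have := section_glue (r1 x hx) (section_mull k (r2 x hx)) (fun v => @match_ x v hx).
  by congr is_section; apply/funext => t; case: ifP.
case: (leP y m) => ym; first by apply: c1; lra.
by apply: section_mull; apply: c2; lra.
Qed.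

(** This is the section with constant value 1 in the chart [v], carried to the chart [w] by
    [alpha]. *)
Lemma section2_chart H a b c d v :
  (forall x y, a <= x <= b -> c <= y <= d -> cocycle_at (H x y) /\ H x y v != 0) ->
  is_section2 H a b c d (fun _ _ w => alpha v w).
Proof.
move=> hH; split=> [x hx|y hy]; split=> // t u w ht hu hw.
  by have [hc hv] := hH x t hx ht; rewrite hc.
by have [hc hv] := hH t y ht hy; rewrite hc.
Qed.

(* Induction on the width of the rectangle and, locally, on its height. *)
Lemma section2_exists H a b c d : a <= b -> c <= d -> charted2 H a b c d ->
  (forall x y, a <= x <= b -> c <= y <= d -> cocycle_at (H x y)) ->
  exists S, is_section2 H a b c d S.
Proof.
move=> ab cd cH cocH.
apply: (@interval_induction R (fun x y => exists S, is_section2 H x y c d S) a b ab).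
  move=> x y z ax xy yz zb [S hS] [S' hS'].
  have [|S'' hS''] := section2_glue cd xy yz _ (section2_swap hS) (section2_swap hS').
    by apply/charted2_swap; apply: charted2_sub cH.
  by exists (swap S''); exact: section2_swap hS''.
move=> t ht.
(* As in the tube lemma, a strip of full height [[c, d]] around [t] carries a section; its
   half-width is the minimum of those found for the pieces glued. *)
have [e e0 h] : exists2 e, 0 < e & forall x y, a <= x -> x <= y -> y <= b ->
    `|x - t| < e -> `|y - t| < e -> exists S, is_section2 H x y c d S.
  apply: (@interval_induction R (fun c' d' => exists2 e, 0 < e &
    forall x y, a <= x -> x <= y ->
    y <= b -> `|x - t| < e -> `|y - t| < e -> exists S, is_section2 H x y c' d' S) c d cd).
    move=> c1 m d1 hc c1m md1 hd [e e0 he] [f f0 hf].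
    exists (Num.min e f); first by rewrite lt_min e0.
    move=> x y ax xy yb; rewrite !lt_min => /andP[xe xf] /andP[ye yf].
    have [S hS] := he x y ax xy yb xe ye; have [S' hS'] := hf x y ax xy yb xf yf.
    by apply: (section2_glue xy c1m md1 _ hS hS'); apply: charted2_sub cH.
  move=> r hr; have [v [e e0 he]] := cH t r ht hr.
  exists e => // c1 d1 hc cd1 hd c1e d1e; exists e => // x y ax xy yb xe ye.
  exists (fun _ _ w => alpha v w); apply: section2_chart => x' y' hx' hy'; split.
    by apply: cocH; lra.
  by move: c1e d1e xe ye; rewrite !ltr_norml => *; apply: he; rewrite ?ltr_norml; lra.
by exists e.
Qed.

Lemma section_exists p a b : a <= b -> charted p a b ->
  (forall t, a <= t <= b -> cocycle_at (p t)) -> exists s, is_section p a b s.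
Proof.
move=> ab cp cocp.
(* A path is treated as a rectangle of width zero. *)
have [||S [hS _]] := @section2_exists (fun _ => p) 0 0 a b (lexx 0) ab.
- move=> x y _ hy; have [v [e e0 h]] := cp y hy.
  by exists v, e => // *; apply: h.
- by move=> x y _; exact: cocp.
- by exists (S 0); apply: hS; rewrite lexx.
Qed.

End Sections.

(** * Arithmetic of the unit interval *)

Section UnitInterval.
Variable R : realType.

Lemma zero_in01 : 0 <= (0 : R) <= 1. Proof. by rewrite lexx ler01. Qed.

Lemma one_in01 : 0 <= (1 : R) <= 1. Proof. by rewrite lexx ler01. Qed.

Lemma half_double : 2^-1 + 2^-1 = 1 :> R.
Proof. by lra. Qed.

End UnitInterval.

(** * Paths in the realization *)

Section RealizationPaths.
Variables (R : realType) (V : finType) (D : complex V).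
Local Notation X := (realization R D).
Local Notation I := (`[0, 1]%classic : set R).
Implicit Types (x y : {ptws V -> R}) (v w : V).

Lemma realization_neq0 x : X x -> exists v, x v != 0.
Proof.
case=> _ + _; apply: contraPP => /forallNP h.
rewrite big1 => [/eqP|v _]; first by rewrite eq_sym oner_eq0.
by apply/eqP; apply: contra_notT (h v).
Qed.

Lemma realization_simplex x (s : {set V}) : X x -> s != finset.set0 ->
  (forall v, v \in s -> x v != 0) -> s \in simplices D.
Proof.
case=> _ _ xD s0 sx; apply: simplex_sub xD s0 _.
by apply/fintype.subsetP => v /sx; rewrite finset.inE.
Qed.

Lemma coord_continuous v : continuous (fun x => x v).
Proof. exact: (@proj_continuous V (fun=> R) v). Qed.

Lemma continuous_coord (T : topologicalType) (f : T -> {ptws V -> R}) :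
  (forall v, continuous (fun t => f t v)) -> continuous f.
Proof.
move=> cf t; apply/cvg_sup => v A.
rewrite nbhsE => -[_ [[B oB <-] Bft] /filterS]; apply.
by apply: (cf v t B); exact: open_nbhs_nbhs.
Qed.

(** The star of [v] is open because coordinates are continuous. *)
Lemma within_star (T : pseudoMetricType R) (A : set T) (f : T -> {ptws V -> R}) z v :
  {within A, continuous f} -> A z -> f z v != 0 ->
  exists2 e, 0 < e & forall z', A z' -> ball z e z' -> f z' v != 0.
Proof.
move=> /subspace_continuousP cf Az fz.
have op : open [set x : {ptws V -> R} | x v != 0].
  apply: (@open_comp _ _ (fun x : {ptws V -> R} => x v) [set r | r != 0]).
    by move=> x _; exact: coord_continuous.
  exact: open_neq.
have : nbhs z [set z' | A z' -> f z' v != 0].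
  by apply: (cf z Az [set x | x v != 0]); exact: open_nbhs_nbhs.
move/nbhs_ballP => [e /= e0 he]; exists e => // z' Az' zz'.
exact: he Az'.
Qed.

Definition vertex_pt v : {ptws V -> R} := fun w => (w == v)%:R.

Lemma vertex_pt_neq0 v w : (vertex_pt v w != 0) = (w == v).
Proof. by rewrite /vertex_pt pnatr_eq0 eqb0 negbK. Qed.

Lemma vertex_pt_realization v : X (vertex_pt v).
Proof.
split=> [w||]; first exact: ler0n.
  rewrite (bigD1 v) //= /vertex_pt eqxx big1 ?addr0 // => w /negPf -> //.
rewrite (_ : finset _ = [set v]%SET) ?simplex1 //.
by apply/finset.setP => w; rewrite !finset.inE vertex_pt_neq0.
Qed.

(** [edge_path] is the instance between two vertices. *)
Definition segment x y : R -> {ptws V -> R} := fun t v => (1 - t) * x v + t * y v.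

Lemma segment_is_path x y (s : {set V}) : X x -> X y -> s \in simplices D ->
  (forall v, x v != 0 -> v \in s) -> (forall v, y v != 0 -> v \in s) ->
  is_path X x y (segment x y).
Proof.
move=> [x0 x1 _] [y0 y1 _] sD xs ys; split.
- apply: continuous_subspaceT; apply: continuous_coord => v t.
  rewrite /segment; apply: cvgD; apply: cvgM; try exact: cvg_cst.
    by apply: cvgB; [exact: cvg_cst|exact: cvg_id].
  exact: cvg_id.
- move=> _ [t + <-]; rewrite IE => It.
  have sum1 : \sum_v segment x y t v = 1.
    by rewrite big_split /= -!mulr_sumr x1 y1; lra.
  split=> //.
    by move=> v; apply: addr_ge0; apply: mulr_ge0 => //; lra.
  apply: (simplex_sub sD); last first.
    apply/fintype.subsetP => v; rewrite finset.inE; apply: contraR => vs.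
    have xv : x v = 0 by apply/eqP; apply: contraR vs; exact: xs.
    have yv : y v = 0 by apply/eqP; apply: contraR vs; exact: ys.
    by rewrite /segment xv yv !mulr0 addr0.
  (* The support is non-empty because the coordinates sum to 1. *)
  apply/negP => /eqP/finset.setP h; have /eqP := sum1.
  rewrite big1 1?eq_sym ?oner_eq0 // => v _.
  by apply/eqP; have := h v; rewrite !finset.inE => /negbFE.
- by apply/funext => v; rewrite /segment subr0 mul1r mul0r addr0.
- by apply/funext => v; rewrite /segment subrr mul0r mul1r add0r.
Qed.

Lemma realization_path x v : X x -> x v != 0 ->
  is_path X x (vertex_pt v) (segment x (vertex_pt v)).
Proof.
move=> Xx xv; have [_ _ xD] := Xx.
apply: segment_is_path Xx (vertex_pt_realization v) xD _ _ => w.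
  by rewrite finset.inE.
by rewrite vertex_pt_neq0 finset.inE => /eqP->.
Qed.

(** The stars of the vertices reachable from [x] and the stars of the other vertices form two open
    sets covering the realization. No point lies in both, since any two vertices of its support are
    joined by a path through it. Connectedness leaves only the first set. *)
Lemma realization_path_connected x v : connected X -> X x ->
  exists p : R -> {ptws V -> R}, is_path X x (vertex_pt v) p.
Proof.
move=> cX Xx; pose W := [set w | exists p : R -> {ptws V -> R}, is_path X x (vertex_pt w) p].
(* Go to [u], back along the segment to [y], then on to [w]. *)
have Wstar y u w : X y -> y u != 0 -> y w != 0 -> W u -> W w.
  move=> Xy yu yw [p hp]; have h1 := prev_is_path (realization_path Xy yu).
  by exists (pcat p (pcat (Defs.prev (segment y (vertex_pt u))) (segment y (vertex_pt w))));
    apply: pcat_is_path hp (pcat_is_path h1 (realization_path Xy yw)).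
have op (A : set V) : open [set y : {ptws V -> R} | exists2 w, A w & y w != 0].
  rewrite (_ : mkset _ = \bigcup_(w in A) [set y : {ptws V -> R} | y w != 0]).
    apply: bigcup_open => w _.
    apply: (@open_comp _ _ (fun x : {ptws V -> R} => x w) [set r | r != 0]).
      by move=> y _; exact: coord_continuous.
    exact: open_neq.
  by [].
pose C := [set y : {ptws V -> R} | exists2 w, W w & y w != 0].
pose C' := [set y : {ptws V -> R} | exists2 w, (~` W) w & y w != 0].
have XC : X `&` C = X.
  apply: cX.
  - have [w xw] := realization_neq0 Xx; exists x; split=> //; exists w => //.
    by exists (segment x (vertex_pt w)); exact: realization_path.
  - by exists C => //; exact: op.
  (* Within the realization, [C] is the complement of the open set [C'], hence relatively closed. *)
  - exists (~` C'); first exact/open_closedC/op.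
    apply/seteqP; split=> y [Xy].
      move=> [u Wu yu]; split=> // -[w Ww yw]; apply: Ww; exact: (Wstar y u w).
    move=> nC'; split=> //; have [w yw] := realization_neq0 Xy; exists w => //.
    by apply: contrapT => Ww; apply: nC'; exists w.
have [_ [w Ww]] : (X `&` C) (vertex_pt v) by rewrite XC; exact: vertex_pt_realization.
by rewrite vertex_pt_neq0 => /eqP <-.
Qed.

Lemma edges_path_is_path (e : dedge D) c : path (fun e f => tau_ e == iota_ f) e c ->
  is_path X (vertex_pt (iota_ e)) (vertex_pt (tau_ (last e c))) (edges_path R e c).
Proof.
have edgeP (f : dedge D) :
    is_path X (vertex_pt (iota_ f)) (vertex_pt (tau_ f)) (edge_path R f).
  have /andP[_ fD] := valP f.
  apply: segment_is_path (vertex_pt_realization _) (vertex_pt_realization _) fD _ _ => v;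
    by rewrite vertex_pt_neq0 !finset.inE => /eqP->; rewrite eqxx ?orbT.
elim: c e => [|f c IHc] e /=; first by move=> _; exact: edgeP.
case/andP => /eqP ef fc; apply: pcat_is_path (edgeP e) _.
by rewrite ef; exact: IHc.
Qed.

End RealizationPaths.

(** * Monodromy of a cocycle along closed paths *)

Section Monodromy.
Variables (R : realType) (V : finType) (D : complex V) (Q : groupType).
Variable alpha : V -> V -> Q.
Hypothesis alphaM : forall u v w, [set u; v; w]%SET \in simplices D ->
  (alpha u v * alpha v w = alpha u w)%g.
Local Notation X := (realization R D).
Local Notation I := (`[0, 1]%classic : set R).
Local Notation sect p s := (is_section alpha p 0 1 s).
Implicit Types (p q : R -> {ptws V -> R}).

Lemma realization_cocycle x : X x -> cocycle_at alpha x.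
Proof.
move=> Xx u v w xu xv xw; apply: alphaM; apply: (realization_simplex Xx).
  by apply/finset.set0Pn; exists u; rewrite !finset.inE eqxx.
by move=> z; rewrite !finset.inE => /orP[/orP[]|] /eqP->.
Qed.

Lemma path_charted x y p : is_path X x y p -> charted p 0 1.
Proof.
move=> [cp pX _ _] t It; have It' : I t by rewrite IE.
have [v pv] : exists v, p t v != 0 by apply: realization_neq0; apply: pX; exists t.
have [e e0 he] := within_star cp It' pv; exists v, e => // u Iu ut.
by apply: he; [rewrite IE|rewrite -ball_normE /= distrC].
Qed.

Lemma path_cocycle x y p : is_path X x y p ->
  forall t, 0 <= t <= 1 -> cocycle_at alpha (p t).
Proof.
by move=> [_ pX _ _] t It; apply: realization_cocycle; apply: pX; exists t; rewrite ?IE.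
Qed.

Lemma path_section x y p : is_path X x y p -> exists s, sect p s.
Proof.
by move=> hp; apply: section_exists (path_charted hp) (path_cocycle hp); exact: ler01.
Qed.

Lemma homotopy_section p q H : is_homotopy X p q H ->
  charted2 (fun x y => H (x, y)) 0 1 0 1 /\
  exists S, is_section2 alpha (fun x y => H (x, y)) 0 1 0 1 S.
Proof.
move=> [cH HX _ _]; have sq x y : 0 <= x <= 1 -> 0 <= y <= 1 -> (I `*` I) (x, y).
  by move=> hx hy; rewrite sqE /= hx.
have ch : charted2 (fun x y => H (x, y)) 0 1 0 1.
  move=> x y hx hy; have [|v hv] := @realization_neq0 R V D (H (x, y)).
    by apply: HX; exists (x, y) => //; exact: sq.
  have [e e0 he] := within_star cH (sq x y hx hy) hv; exists v, e => // x' y' hx' hy' xx yy.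
  by apply: he; [exact: sq|split; rewrite -ball_normE /= distrC].
split=> //; apply: section2_exists ch _; rewrite ?ler01 // => x y hx hy.
by apply: realization_cocycle; apply: HX; exists (x, y) => //; exact: sq.
Qed.

(* Meant for closed paths p only. *)
Definition trivial_monodromy p :=
  exists2 s, sect p s & forall v, p 0 v != 0 -> s 0 v = s 1 v.

(** Any section and any chart may test the monodromy. By [section_uniq] two sections have the same
    ratio at both ends, and a chart change acts by the same factor at both ends because the path is
    closed. *)
Lemma trivial_monodromyP x p s v : is_path X x x p -> sect p s -> x v != 0 ->
  trivial_monodromy p <-> s 0 v = s 1 v.
Proof.
move=> hp hs xv; have [_ _ p0 p1] := hp.
split=> [[s' hs' h]|e].
  have := section_uniq (path_charted hp) hs' hs (t := 0) (u := 1) (v := v) (w := v)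
    (zero_in01 R) (one_in01 R).
  by rewrite p0 p1 h ?p0 // => /(_ xv xv) /mulIg.
exists s => // w; rewrite p0 => xw.
by rewrite (hs.1 0 v) ?(zero_in01 R) ?p0 // (hs.1 1 v) ?(one_in01 R) ?p1 // e.
Qed.

(** With [pcat_sectionr], cuts one section of a concatenation into sections of the factors, whose
    end values can then be compared at the junction. *)
Lemma pcat_sectionl p q s : sect (pcat p q) s -> sect p (fun t => s (2^-1 * t)).
Proof.
move=> hs.
have hs' : is_section alpha (pcat p q) (2^-1 * 0 + 0) (2^-1 * 1 + 0) s.
  by apply: section_sub hs; lra.
have := section_affine _ hs'; rewrite invr_gt0 ltr0n => /(_ isT) /section_ext h.
have -> : (fun t => s (2^-1 * t)) = (fun t => s (2^-1 * t + 0)).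
  by apply/funext => t; rewrite addr0.
apply: h => t It; rewrite /pcat addr0 ifT; last by lra.
by rewrite mulVKf // pnatr_eq0.
Qed.

Lemma pcat_sectionr p q s : p 1 = q 0 -> sect (pcat p q) s ->
  sect q (fun t => s (2^-1 * t + 2^-1)).
Proof.
move=> pq hs.
have hs' : is_section alpha (pcat p q) (2^-1 * 0 + 2^-1) (2^-1 * 1 + 2^-1) s.
  by apply: section_sub hs; lra.
have := section_affine _ hs'; rewrite invr_gt0 ltr0n => /(_ isT) /section_ext.
apply => t It; rewrite /pcat; case: ifPn => h.
  (* At the junction [pcat] takes the value of [p], which [pq] turns into that of [q]. *)
  have -> : t = 0 by lra.
  by rewrite mulr0 add0r divff ?pnatr_eq0.
by congr q; lra.
Qed.

Lemma prev_section p s : sect (Defs.prev p) s -> sect p (fun t => s (1 - t)).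
Proof.
move=> hs; have hs' : is_section alpha (Defs.prev p) (1 - 1) (1 - 0) s.
  by rewrite subrr subr0.
by have /section_ext := section_rev hs'; apply => t _; rewrite /Defs.prev subKr.
Qed.

(* In a flat section over the square, the ratio of the values on the two sides
   identified by the homotopy of closed paths is constant. *)
Lemma trivial_monodromy_free x y p q : is_path X x x p -> is_path X y y q ->
  freely_homotopic X p q -> trivial_monodromy p <-> trivial_monodromy q.
Proof.
move=> hp hq [H hH H01]; have [chH [S [rS cS]]] := homotopy_section hH.
have [_ _ Hp Hq] := hH.
have Sp : sect p (S 0).
  by apply: section_ext (rS 0 (zero_in01 R)) => t It; rewrite Hp ?I_in.
have Sq : sect q (S 1).
  by apply: section_ext (rS 1 (one_in01 R)) => t It; rewrite Hq ?I_in.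
(* As [H (t, 0) = H (t, 1)], the restrictions of [S] to these two sides are sections along the same
   path. *)
have S1 : is_section alpha (fun t => H (t, 0)) 0 1 (S^~ 1).
  by apply: section_ext (cS 1 (one_in01 R)) => t It; rewrite H01 ?I_in.
have [_ pX p0 p1] := hp; have [_ qX q0 q1] := hq.
have [v xv] : exists v, x v != 0.
  by rewrite -p0; apply: realization_neq0; apply: pX; exists 0; rewrite ?IE ?zero_in01.
have [w yw] : exists w, y w != 0.
  by rewrite -q0; apply: realization_neq0; apply: qX; exists 0; rewrite ?IE ?zero_in01.
rewrite (trivial_monodromyP hp Sp xv) (trivial_monodromyP hq Sq yw).
have := section_uniq (charted2_col chH (zero_in01 R)) (cS 0 (zero_in01 R)) S1 (t := 0) (u := 1)
  (v := v) (w := w)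
  (zero_in01 R) (one_in01 R).
have H00 : H (0, 0) = x by rewrite Hp ?I_in ?zero_in01.
have H10 : H (1, 0) = y by rewrite Hq ?I_in ?zero_in01.
rewrite /= H00 H10 => /(_ xv yw) e.
by split=> h; apply/eqP; rewrite eq_sym -divg_eq1; apply/eqP; move: e; rewrite h mulgV.
Qed.

Lemma trivial_monodromy_cst x : X x -> trivial_monodromy (cst x).
Proof.
move=> Xx; have [v xv] := realization_neq0 Xx.
exists (fun _ w => alpha v w) => //; split=> // t u w _ xu xw.
by rewrite (realization_cocycle Xx).
Qed.

Lemma trivial_monodromy_cat x p q : is_path X x x p -> is_path X x x q ->
  trivial_monodromy p -> trivial_monodromy q -> trivial_monodromy (pcat p q).
Proof.
move=> hp hq; have hpq := pcat_is_path hp hq; have [s hs] := path_section hpq.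
have [_ pX p0 p1] := hp; have [_ _ q0 _] := hq.
have [v xv] : exists v, x v != 0.
  by rewrite -p0; apply: realization_neq0; apply: pX; exists 0; rewrite ?IE ?zero_in01.
have pq : p 1 = q 0 by rewrite p1.
rewrite (trivial_monodromyP hpq hs xv).
rewrite (trivial_monodromyP hp (pcat_sectionl hs) xv).
rewrite (trivial_monodromyP hq (pcat_sectionr pq hs) xv).
by rewrite !mulr0 !mulr1 add0r half_double => -> ->.
Qed.

Lemma trivial_monodromy_prev x p : is_path X x x p ->
  trivial_monodromy p -> trivial_monodromy (Defs.prev p).
Proof.
move=> hp; have hv := prev_is_path hp; have [s hs] := path_section hv.
have [_ pX p0 _] := hp.
have [v xv] : exists v, x v != 0.
  by rewrite -p0; apply: realization_neq0; apply: pX; exists 0; rewrite ?IE ?zero_in01.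
rewrite (trivial_monodromyP hp (prev_section hs) xv) (trivial_monodromyP hv hs xv).
by rewrite subr0 subrr => ->.
Qed.

(** The outward and the return passage yield two sections along [r]. Their ratio is constant: at the
    start of [r] it compares the two ends of the whole path, at the end of [r] the two ends of
    [p]. *)
Lemma trivial_monodromy_conj x y r p : is_path X x y r -> is_path X y y p ->
  trivial_monodromy (pcat r (pcat p (Defs.prev r))) <-> trivial_monodromy p.
Proof.
move=> hr hp; have hv := prev_is_path hr; have hpv := pcat_is_path hp hv.
have hrpv := pcat_is_path hr hpv; have [s hs] := path_section hrpv.
have [_ rX r0 r1] := hr; have [_ _ p0 p1] := hp.
have [v xv] : exists v, x v != 0.
  by rewrite -r0; apply: realization_neq0; apply: rX; exists 0; rewrite ?IE ?zero_in01.
have [w yw] : exists w, y w != 0.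
  by rewrite -r1; apply: realization_neq0; apply: rX; exists 1; rewrite ?IE ?one_in01.
have e1 : r 1 = pcat p (Defs.prev r) 0 by have [_ _ -> _] := hpv.
have e2 : p 1 = Defs.prev r 0 by have [_ _ -> _] := hv.
have ha := pcat_sectionl hs; have hb := pcat_sectionr e1 hs.
have hb1 := pcat_sectionl hb; have hb2 := prev_section (pcat_sectionr e2 hb).
rewrite (trivial_monodromyP hrpv hs xv) (trivial_monodromyP hp hb1 yw).
have := section_uniq (path_charted hr) ha hb2 (t := 0) (u := 1) (v := v) (w := w)
  (zero_in01 R) (one_in01 R).
rewrite r0 r1 => /(_ xv yw).
rewrite !subr0 !subrr !mulr0 !mulr1 !add0r half_double mulr1 half_double.
by move=> e; split=> h; apply/eqP; move: e; rewrite h mulgV => /eqP;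
  rewrite ?divg_eq1 1?eq_sym ?divg_eq1 // eq_sym.
Qed.

(** Along an edge the section is constant in the chart of the initial vertex up to the midpoint and
    in that of the terminal vertex afterwards. The chart change at the midpoint gives one factor
    [alpha]. *)
Lemma edges_path_section (e : dedge D) c s :
  path (fun e f => tau_ e == iota_ f) e c -> sect (edges_path R e c) s ->
  s 1 (tau_ (last e c)) =
    (s 0 (iota_ e) * \prod_(f <- e :: c) alpha (iota_ f) (tau_ f))%g.
Proof.
have edgeS (f : dedge D) s' : sect (edge_path R f) s' ->
    s' 1 (tau_ f) = (s' 0 (iota_ f) * alpha (iota_ f) (tau_ f))%g.
  move=> [h1 h2]; have /andP[nf _] := valP f.
  have nf' : (iota_ f == tau_ f) = false by apply/negbTE.
  have half0 : 0 <= (2^-1 : R) by lra.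
  have half1 : (2^-1 : R) <= 1 by lra.
  have fi t : t <= 2^-1 -> edge_path R f t (iota_ f) != 0.
    move=> ht; rewrite /edge_path eqxx nf' mulr1 mulr0 addr0.
    by apply: lt0r_neq0; lra.
  have ft t : 2^-1 <= t -> edge_path R f t (tau_ f) != 0.
    move=> ht; rewrite /edge_path eqxx (eq_sym (tau_ f)) nf' mulr1 mulr0 add0r.
    by apply: lt0r_neq0; lra.
  rewrite (h2 0 2^-1 (iota_ f)) // => [|t /andP[_ /fi]//].
  rewrite -h1 ?half0 ?fi ?ft // -(h2 2^-1 1 (tau_ f)) // => t /andP[/ft]//.
elim: c e s => [|f c IHc] e s /=.
  by move=> _ /edgeS; rewrite big_seq1.
case/andP => /eqP ef fc hs.
have pe := @edges_path_is_path R V D e [::] isT.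
have pf := @edges_path_is_path R V D f c fc.
have [_ _ _ /= pe1] := pe; have [_ _ pf0 _] := pf.
have := edgeS e _ (pcat_sectionl hs); have := IHc f _ fc (pcat_sectionr _ hs).
rewrite !mulr0 !mulr1 !add0r half_double.
rewrite pe1 pf0 /= ef => /(_ erefl) -> h.
by rewrite [in RHS]big_cons ef mulgA -h.
Qed.

Lemma trivial_monodromy_cycle (c : seq (dedge D)) : dcycle c ->
  trivial_monodromy (Defs.cycle_path R c) <->
  (\prod_(e <- c) alpha (iota_ e) (tau_ e) = 1)%g.
Proof.
case: c => // e c; rewrite /dcycle /= rcons_path => /andP[ec /eqP cl].
have := @edges_path_is_path R V D e c ec; rewrite cl => hp.
have [s hs] := path_section hp.
have ve : vertex_pt R (iota_ e) (iota_ e) != 0 by rewrite vertex_pt_neq0.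
rewrite (trivial_monodromyP hp hs ve) -{2}cl (edges_path_section ec hs).
split=> [h|->]; last by rewrite mulg1.
by apply: (@mulgI _ (s 0 (iota_ e))); rewrite -h mulg1.
Qed.

(** * Monodromy on the fundamental group *)

Section Pi1Monodromy.
Local Open Scope quotient_scope.
Variable x0 : X.

(** A homotopy with fixed ends is a free homotopy of closed paths, so triviality depends on the
    class only. *)
Lemma trivial_monodromy_repr (p : loop R x0) :
  trivial_monodromy (repr (\pi_(pi1 R x0) p)) <-> trivial_monodromy p.
Proof.
apply: trivial_monodromy_free (loopP _) (loopP _) _.
have [H hH Hs] := repr_pi1 p; exists H => // t /Hs[-> ->].
by have [_ _ -> ->] := loopP (repr (\pi_(pi1 R x0) p)).
Qed.

Lemma trivial_monodromy_normal :
  normal_subgroup [set a : pi1 R x0 | trivial_monodromy (repr a)].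
Proof.
split.
- by apply/trivial_monodromy_repr/trivial_monodromy_cst; exact: set_mem (valP x0).
- elim/quotW => p; elim/quotW => q /trivial_monodromy_repr hp /trivial_monodromy_repr hq.
  rewrite /= -[(_ * _)%g]/(pi1_mul _ _) pi1_mulE; apply/trivial_monodromy_repr.
  exact: trivial_monodromy_cat (loopP p) (loopP q) hp hq.
- elim/quotW => p /trivial_monodromy_repr hp.
  rewrite /= -[(_^-1)%g]/(pi1_inv _) pi1_invE; apply/trivial_monodromy_repr.
  exact: trivial_monodromy_prev (loopP p) hp.
- elim/quotW => p; elim/quotW => q /trivial_monodromy_repr hp.
  rewrite /= conjgE -[(_ * _)%g]/(pi1_mul (pi1_inv _) (pi1_mul _ _)).
  rewrite pi1_invE (pi1_mulE p q) pi1_mulE; apply/trivial_monodromy_repr.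
  (* The conjugating path [r] is the reverse of [q], whose own reverse is [q] again. *)
  have /(trivial_monodromy_conj (prev_is_path (loopP q)) (loopP p)) := hp.
  rewrite (_ : Defs.prev (Defs.prev q) = q) //.
  by apply/funext => t; rewrite /Defs.prev subKr.
Qed.

Lemma trivial_monodromy_cycle_class (c : seq (dedge D)) : dcycle c ->
  (\prod_(e <- c) alpha (iota_ e) (tau_ e) = 1)%g ->
  cycle_class x0 c `<=` [set a : pi1 R x0 | trivial_monodromy (repr a)].
Proof.
move=> cc /(trivial_monodromy_cycle cc) h _ [q -> hq] /=.
apply/trivial_monodromy_repr; move: cc h hq; case: c => // e c.
rewrite /dcycle /= rcons_path => /andP[ec /eqP cl] h.
have := @edges_path_is_path R V D e c ec; rewrite cl => hp hq.
exact/(trivial_monodromy_free (loopP q) hp hq).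
Qed.

(** The path of [c] need not start at [x0]. Connectedness gives a path [r] from [x0] to its first
    vertex, and conjugating by [r] yields a loop at [x0] whose monodromy is trivial exactly when
    that of [c] is. *)
Lemma trivial_monodromy_loops (c : seq (dedge D)) : connected X ->
  (forall a : pi1 R x0, trivial_monodromy (repr a)) -> dcycle c ->
  (\prod_(e <- c) alpha (iota_ e) (tau_ e) = 1)%g.
Proof.
move=> cX h cc; apply/(trivial_monodromy_cycle cc).
move: cc; case: c => // e c.
rewrite /dcycle /= rcons_path => /andP[ec /eqP cl].
have := @edges_path_is_path R V D e c ec; rewrite cl => hp.
have [r hr] := realization_path_connected (iota_ e) cX (set_mem (valP x0)).
apply/(trivial_monodromy_conj hr hp).
pose l := Loop (pcat_is_path hr (pcat_is_path hp (prev_is_path hr))).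
exact/(@trivial_monodromy_repr l).
Qed.

End Pi1Monodromy.

End Monodromy.

(** * The cocycle of [n]-th powers of edges *)

Section RelatorImages.
Variables (V : finType) (D : complex V) (Q : groupType).
Variable f : UMagmaMorphism.type (freeg (dedge D)) Q.

Lemma gmulf_relator c n :
  f (relator c n) = (\prod_(e <- c) zexpg (f (fgen e)) n)%g.
Proof. by rewrite gmulf_prod; apply: eq_bigr => e _; exact: gmulf_zexpg. Qed.

Lemma relator2_eq1 c n : size c = 2%N ->
  f (relator c 1) = 1%g -> f (relator c n) = 1%g.
Proof.
case: c => [|x [|y []]] // _; rewrite !gmulf_relator !big_cons !big_nil !mulg1.
exact: zexpg_mul_eq1.
Qed.

Lemma relator3_eq1 c n : size c = 3%N ->
  f (relator c 1) = 1%g -> f (relator c (-1)) = 1%g -> f (relator c n) = 1%g.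
Proof.
case: c => [|x [|y [|z []]]] // _.
rewrite !gmulf_relator !big_cons !big_nil !mulg1 !mulgA.
exact: zexpg_mul3_eq1.
Qed.

(** The default 1 is the value that the cocycle condition requires for [u = v], where there is no
    directed edge. *)
Definition transition (n : int) (u v : V) : Q :=
  if insub (u, v) is Some e then zexpg (f (fgen (e : dedge D))) n else 1%g.

Lemma transition_dedge n (e : dedge D) :
  transition n (iota_ e) (tau_ e) = zexpg (f (fgen e)) n.
Proof. by rewrite /transition -surjective_pairing valK. Qed.

Lemma prod_transition n c :
  (\prod_(e <- c) transition n (iota_ e) (tau_ e))%g = f (relator c n).
Proof. by rewrite gmulf_relator; apply: eq_bigr => e _; exact: transition_dedge. Qed.

Lemma transition_id n u : transition n u u = 1%g.
Proof. by rewrite /transition insubF // /is_dedge eqxx. Qed.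

Lemma dedge_exists u v (s : {set V}) : s \in simplices D ->
  u \in s -> v \in s -> u != v -> exists e : dedge D, iota_ e = u /\ tau_ e = v.
Proof.
move=> sD us vs uv; have ed : is_dedge D (u, v).
  rewrite /is_dedge uv; apply: simplex_sub sD _ _.
    by apply/finset.set0Pn; exists u; rewrite !finset.inE eqxx.
  by apply/fintype.subsetP => w; rewrite !finset.inE => /orP[] /eqP->.
by exists (Sub (u, v) ed).
Qed.

Hypothesis f_short : forall r, short_relators D r -> f r = 1%g.

(** For distinct vertices, the 3-cycle makes the product of the two factors with [transition n w u]
    trivial, and a 2-cycle identifies this third factor as the inverse of [transition n u w].
    Coinciding vertices leave an identity or a 2-cycle. *)
Lemma transitionM n u v w : [set u; v; w]%SET \in simplices D ->
  (transition n u v * transition n v w = transition n u w)%g.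
Proof.
move=> sD; set s := finset.setU _ _ in sD.
have [us vs ws] : [/\ u \in s, v \in s & w \in s].
  by rewrite !finset.inE !eqxx !orbT.
have tV a b : a \in s -> b \in s -> a != b ->
    (transition n a b * transition n b a = 1)%g.
  move=> as_ bs ab; have [e [ie te]] := dedge_exists sD as_ bs ab.
  have ba : b != a by rewrite eq_sym.
  have [e' [ie' te']] := dedge_exists sD bs as_ ba.
  have cc : dcycle [:: e; e'] by rewrite /dcycle /= te ie' te' ie !eqxx.
  have := prod_transition n [:: e; e'].
  rewrite !big_cons big_nil mulg1 ie te ie' te' => ->.
  by apply: relator2_eq1 => //; apply: f_short; left; exists [:: e; e'].
have [->|uv] := eqVneq u v; first by rewrite transition_id mul1g.
have [->|vw] := eqVneq v w; first by rewrite transition_id mulg1.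
have [<-|uw] := eqVneq u w; first by rewrite tV // transition_id.
have wu : w != u by rewrite eq_sym.
have [e1 [i1 t1]] := dedge_exists sD us vs uv.
have [e2 [i2 t2]] := dedge_exists sD vs ws vw.
have [e3 [i3 t3]] := dedge_exists sD ws us wu.
have cc : dcycle [:: e1; e2; e3] by rewrite /dcycle /= t1 i2 t2 i3 t3 i1 !eqxx.
have := prod_transition n [:: e1; e2; e3].
rewrite !big_cons big_nil mulg1 i1 t1 i2 t2 i3 t3 relator3_eq1 //; first last.
- by apply: f_short; right; exists [:: e1; e2; e3] => //; split=> //; right.
- by apply: f_short; right; exists [:: e1; e2; e3] => //; split=> //; left.
by move=> h; apply: (@mulIg _ (transition n w u)); rewrite -mulgA h tV.
Qed.

End RelatorImages.

Theorem proposition2 (R : realType) (V : finType) (D : complex V)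
    (D_nonempty : (0 < #|V|)%N) (D_flag : flag D)
    (D_connected : connected (realization R D)) :
  [/\ (* (a) *)
      forall (c : seq (dedge D)) (n : int),
        dcycle c -> size c = 2%N -> n != 0 ->
        normal_closure [set relator c 1] (relator c n),
      (* (b) *)
      forall (c : seq (dedge D)) (n : int),
        dcycle c -> size c = 3%N -> n != 0 ->
        normal_closure [set relator c 1; relator c (-1)] (relator c n)
    & (* (c) *)
      forall (x0 : realization R D) (m : nat) (c_ : 'I_m -> seq (dedge D)),
        (forall i, dcycle (c_ i)) ->
        normal_closure (\bigcup_i cycle_class x0 (c_ i)) = [set: pi1 R x0] ->
        forall (c : seq (dedge D)) (n : int),
          dcycle c -> (2 <= size c)%N -> n != 0 ->
          normal_closure (short_relators D `|` power_relators c_)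
            (relator c n)].
Proof.
(* Being a consequence of [S] is tested as triviality in the quotient by the normal closure of
   [S]. *)
have piS (S : set (freeg (dedge D))) r : S r ->
    quotg_pi (normal_closure_normal S) r = 1%g.
  by move=> Sr; apply/quotg_pi_eq1; exact: sub_normal_closure.
split=> [c n _ c2 _|c n _ c3 _|x0 m c_ dc_ gen c n dc _ n0].
- apply/(quotg_pi_eq1 (normal_closure_normal _)); apply: relator2_eq1 => //.
  exact: piS.
- apply/(quotg_pi_eq1 (normal_closure_normal _)); apply: relator3_eq1 => //.
    by apply: piS; left.
  by apply: piS; right.
set S := _ `|` _; apply/(quotg_pi_eq1 (normal_closure_normal S)).
pose al := transition (quotg_pi (normal_closure_normal S)) n.
have alM u v w : [set u; v; w]%SET \in simplices D -> (al u v * al v w = al u w)%g.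
  by apply: transitionM => r hr; apply: piS; left.
rewrite -prod_transition.
apply: (trivial_monodromy_loops alM (x0 := x0)) => // a.
(* By [gen], the normal subgroup of classes with trivial monodromy is everything once it contains
   the classes of the [c_ i]. *)
have : [set: pi1 R x0] a by [].
rewrite -gen => /(normal_closure_min (trivial_monodromy_normal alM x0)); apply.
move=> b [i _]; apply: (trivial_monodromy_cycle_class alM) => //.
(* The monodromy along [c_ i] is the image of its relator with the same exponent [n] as the
   target. *)
by rewrite prod_transition; apply: piS; right; exists i, n.
Qed.
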